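(* Fix any integer $r \geq 2$. Then any partially symmetric tensor $T \in \mathrm{Sym}^{d_1}\mathbb{C}^{n_1+1} \otimes \cdots \otimes \mathrm{Sym}^{d_k}\mathbb{C}^{n_k+1}$ (with $d_i,n_i\ge1$) can be written as a Hadamard product $T=A_1\star\cdots\star A_m$ of finitely many partially symmetric tensors $A_1,\ldots,A_m\in \mathrm{Sym}^{d_1}\mathbb{C}^{n_1+1} \otimes \cdots \otimes \mathrm{Sym}^{d_k}\mathbb{C}^{n_k+1}$ of partially symmetric rank at most $r$.
   Context: The partially symmetric rank of a tensor $T\in \mathrm{Sym}^{d_1}\mathbb{C}^{n_1+1} \otimes \cdots \otimes \mathrm{Sym}^{d_k}\mathbb{C}^{n_k+1}$ is the smallest $s$ such that $T=\sum_{i=1}^s \mathbf{v}_{i,1}^{\otimes d_1}\otimes\cdots\otimes\mathbf{v}_{i,k}^{\otimes d_k}$ with $\mathbf{v}_{i,j}\in\mathbb{C}^{n_j+1}$. The Hadamard product $\star$ is the entry-wise product of tensors with respect to the standard bases of the $\mathbb{C}^{n_j+1}$. Equivalently, one uses coordinates on $\mathrm{Sym}^{d_1}\mathbb{C}^{n_1+1} \otimes \cdots \otimes \mathrm{Sym}^{d_k}\mathbb{C}^{n_k+1}$ indexed by tuples $(\alpha_1,\ldots,\alpha_k)$, $\alpha_i\in\mathbb{Z}_{\ge0}^{n_i+1}$, $|\alpha_i|=d_i$, in which $\mathbf{x}_1^{\otimes d_1}\otimes\cdots\otimes\mathbf{x}_k^{\otimes d_k}$ has coordinates $\mathbf{x}_1^{\alpha_1}\cdots\mathbf{x}_k^{\alpha_k}$,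 and multiplies coordinate by coordinate. *)

(* Defs.v *)
From HB Require Import structures.
From mathcomp Require Import all_boot all_order all_algebra all_fingroup.
From mathcomp Require Import reals complex.

Set Implicit Arguments.
Unset Strict Implicit.
Unset Printing Implicit Defensive.

Import GRing.Theory.
Local Open Scope ring_scope.

(* Index of an entry, in the standard bases, of a tensor in
   (C^(n_1 + 1))^{(x) d_1} (x) ... (x) (C^(n_k + 1))^{(x) d_k}: the index [a]
   stands for the tensor product over all i and all j < d_i of the basis
   vectors e_(a i j) of C^(n_i + 1). *)
Definition tindex (k : nat) (d n : 'I_k -> nat) : finType :=
  {dffun forall i : 'I_k, {ffun 'I_(d i) -> 'I_(n i).+1}}.

Definition tensor (C : comNzRingType) (k : nat) (d n : 'I_k -> nat) : Type :=
  {ffun tindex d n -> C}.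

(* [Sym^{d_1} (x) ... (x) Sym^{d_k}] is the space of tensors invariant under
   permutations of the factors inside each of the k blocks. *)
Definition tindex_perm (k : nat) (d n : 'I_k -> nat)
    (s : forall i : 'I_k, {perm 'I_(d i)}) (a : tindex d n) : tindex d n :=
  [ffun i : 'I_k => [ffun j : 'I_(d i) => a i (s i j)]].

Definition partially_symmetric (C : comNzRingType) (k : nat)
    (d n : 'I_k -> nat) (T : tensor C d n) : Prop :=
  forall (s : forall i : 'I_k, {perm 'I_(d i)}) (a : tindex d n),
    T (tindex_perm s a) = T a.

(* v_1^{(x) d_1} (x) ... (x) v_k^{(x) d_k} *)
Definition power_tensor (C : comNzRingType) (k : nat) (d n : 'I_k -> nat)
    (v : forall i : 'I_k, 'rV[C]_(n i).+1) : tensor C d n :=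
  [ffun a : tindex d n => \prod_(i < k) \prod_(j < d i) v i ord0 (a i j)].

Definition has_ps_decomposition (C : comNzRingType) (k : nat)
    (d n : 'I_k -> nat) (T : tensor C d n) (s : nat) : Prop :=
  exists v : 'I_s -> forall i : 'I_k, 'rV[C]_(n i).+1,
    T = \sum_(l < s) power_tensor d (v l).

(* The rank is a relation because the minimum is over a set of naturals that
   could a priori be empty. *)
Definition is_ps_rank (C : comNzRingType) (k : nat) (d n : 'I_k -> nat)
    (T : tensor C d n) (s : nat) : Prop :=
  has_ps_decomposition T s /\
  forall t : nat, has_ps_decomposition T t -> (s <= t)%N.

Definition hadamard_prod (C : comNzRingType) (k : nat) (d n : 'I_k -> nat)
    (m : nat) (A : 'I_m -> tensor C d n) : tensor C d n :=
  [ffun a : tindex d n => \prod_(l < m) A l a].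

(* Main.v *)
Require Import Defs.
From mathcomp Require Import all_boot all_order all_algebra all_fingroup.
From mathcomp Require Import reals complex.
From mathcomp Require Import boolp.

(** Hadamard multiplication of tensors is multiplication of functions of the
    index, so a polynomial expression in a single tensor [u], evaluated entry
    by entry, is a Hadamard product as soon as the polynomial splits into
    linear factors.  Over an algebraically closed field every polynomial does.

    Take [u] to be a power tensor [x_1^{(x) d_1} (x) ... (x) x_k^{(x) d_k}].
    The factors then have the form [a u + b 1], where [1] is the all-ones
    tensor, itself the power tensor of all-ones vectors.  Scalars are absorbed
    into one of the vectors by extracting a root of order [d_i >= 1], so each
    factor is a sum of two power tensors
    ([has_ps_decomposition_affine_power_tensor]) and has rank at most 2.

    It remains to write an arbitrary partially symmetric [T] as [p(u)].  By
    interpolation ([interpolation_fiber]) this is possible once [T] is constant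
    on the fibres of [u].  Choose the coordinates of [x_1, ..., x_k] to be
    pairwise distinct prime numbers: by unique factorization the entry of [u]
    at an index [a] determines how often each basis vector occurs in each block
    of [a], that is, determines [a] up to permutations inside the blocks
    ([prime_product_tindex_perm]), which is all that [T] sees. *)

Section HadamardFactorization.
Set Implicit Arguments.
Unset Strict Implicit.
Unset Printing Implicit Defensive.
Import GRing.Theory Num.Theory.
Local Open Scope ring_scope.

Lemma exists_ps_rank_le (C : comNzRingType) (k : nat) (d n : 'I_k -> nat)
    (T : tensor C d n) (s : nat) :
  has_ps_decomposition T s -> exists t, is_ps_rank T t /\ (t <= s)%N.
Proof.
move=> Ts; have exT : exists s, `[< has_ps_decomposition T s >].
  by exists s; apply/asboolP.
case: (ex_minnP exT) => t /asboolP Tt tmin.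
by exists t; split; [split=> // t' T't' |]; apply: tmin; apply/asboolP.
Qed.

Lemma partially_symmetric_power_tensor (C : comNzRingType) (k : nat)
    (d n : 'I_k -> nat) (v : forall i : 'I_k, 'rV[C]_(n i).+1) :
  partially_symmetric (power_tensor d v).
Proof.
move=> s a; rewrite !ffunE; apply: eq_bigr => i _.
rewrite [RHS](reindex_inj (@perm_inj _ (s i))).
by apply: eq_bigr => j _; rewrite !ffunE.
Qed.

(** One block with [d i0 > 0] suffices to absorb a scalar: multiply its vector
    by a root of order [d i0]. *)
Lemma power_tensor_absorb_scalar (C : numClosedFieldType) (k : nat)
    (d n : 'I_k -> nat) (i0 : 'I_k) (v : forall i : 'I_k, 'rV[C]_(n i).+1)
    (c : C) :
  (0 < d i0)%N ->
  exists w : forall i : 'I_k, 'rV[C]_(n i).+1,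
    forall a, power_tensor d w a = c * power_tensor d v a.
Proof.
move=> d_gt0; pose z i := if i == i0 then (d i0).-root c else 1.
exists (fun i => z i *: v i) => a; rewrite !ffunE.
have -> : c = \prod_(i < k) z i ^+ d i.
  rewrite (bigD1 i0) //= /z eqxx rootCK // big1 ?mulr1 // => i /negPf ->.
  by rewrite expr1n.
rewrite -big_split; apply: eq_bigr => i _ /=.
rewrite -[X in z i ^+ X]card_ord -prodr_const -big_split.
by apply: eq_bigr => j _; rewrite mxE.
Qed.

Lemma has_ps_decomposition_affine_power_tensor (C : numClosedFieldType)
    (k : nat) (d n : 'I_k -> nat) (i0 : 'I_k)
    (v : forall i : 'I_k, 'rV[C]_(n i).+1) (b c : C) :
  (0 < d i0)%N ->
  has_ps_decomposition
    ([ffun a => b * power_tensor d v a + c] : tensor C d n) 2.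
Proof.
move=> d_gt0.
have [w wE] := power_tensor_absorb_scalar v b d_gt0.
have [w1 w1E] :=
  power_tensor_absorb_scalar (fun i => const_mx 1 : 'rV[C]_(n i).+1) c d_gt0.
exists (fun l => if l == ord0 then w else w1).
apply/ffunP => a; rewrite sum_ffunE !big_ord_recl big_ord0 /= wE w1E addr0.
rewrite [LHS]ffunE; congr (_ + _); rewrite ffunE big1 ?mulr1 // => i _.
by rewrite big1 // => j _; rewrite mxE.
Qed.

(** The polynomial is corrected one index at a time by a multiple of the
    polynomial vanishing at the nodes already treated; an index whose node has
    been met before already has the right value. *)
Lemma interpolation_fiber (F : fieldType) (I : finType) (u t : I -> F) :
  (forall a b, u a = u b -> t a = t b) ->
  exists p : {poly F}, forall a, p.[u a] = t a.
Proof.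
move=> ut.
suff [p pE] : exists p : {poly F}, forall a, a \in enum I -> p.[u a] = t a.
  by exists p => a; apply: pE; rewrite mem_enum.
elim: (enum I) => [|a s [p pE]]; first by exists 0.
have [/mapP[b bs uab] | uas] := boolP (u a \in [seq u b | b <- s]).
  exists p => a'; rewrite inE => /predU1P[->|/pE//].
  by rewrite uab pE //; apply: ut.
pose q := \prod_(b <- s) ('X - (u b)%:P).
have q_a : q.[u a] != 0.
  rewrite horner_prod prodf_seq_neq0; apply/allP => b bs /=.
  rewrite hornerXsubC subr_eq0; apply: contraNneq uas => ->.
  exact: map_f.
exists (p + ((t a - p.[u a]) / q.[u a])%:P * q) => a'; rewrite inE.
rewrite hornerD hornerM hornerC => /predU1P[->|a's].
  by rewrite divfK // addrC subrK.
suff -> : q.[u a'] = 0 by rewrite mulr0 addr0 pE.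
apply/eqP; rewrite horner_prod prodf_seq_eq0; apply/hasP; exists a' => //=.
by rewrite hornerXsubC subrr.
Qed.

Lemma exists_distinct_primes (I : countType) :
  exists q : I -> nat, injective q /\ forall i, prime (q i).
Proof.
pose fix q (m : nat) : nat :=
  if m is m'.+1 then s2val (prime_above (q m')) else 2%N.
have q_mono : {homo q : i j / (i < j)%N}.
  by apply: homo_ltn => [? ? ?|m /=]; [apply: ltn_trans | case: prime_above].
exists (q \o pickle); split; last first.
  by move=> i /=; case: (pickle i) => //= m; case: prime_above.
apply: inj_comp (pcan_inj pickleK) => m m' /eqP qmm'.
by case: (ltngtP m m') qmm' => // /q_mono; case: ltngtP.
Qed.

Lemma eq_occurrences_tindex_perm (k : nat) (d n : 'I_k -> nat)
    (a b : tindex d n) :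
  (forall i (l : 'I_(n i).+1),
     #|[pred j | a i j == l]| = #|[pred j | b i j == l]|) ->
  exists s : forall i : 'I_k, {perm 'I_(d i)}, a = tindex_perm s b.
Proof.
move=> eq_ab.
suff /fin_all_exists[s sE] (i : 'I_k) :
    exists s : {perm 'I_(d i)}, forall j, a i j = b i (s j).
  by exists s; apply/ffunP => i; apply/ffunP => j; rewrite !ffunE.
have /tuple_permP[s /val_inj sE] :
    perm_eq [tuple a i j | j < d i] [tuple b i j | j < d i].
  apply/allP => l _ /=; apply/eqP; rewrite !count_map -!size_filter.
  by have := eq_ab i l; rewrite !cardE /enum_mem.
by exists s => j; have := congr1 (fun t => tnth t j) sE; rewrite !tnth_mktuple.
Qed.

(** The primes of different blocks being distinct, only block [i] contributes,
    by one for each of its positions holding [l]. *)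
Lemma logn_prime_product (k : nat) (d n : 'I_k -> nat)
    (q : {i : 'I_k & 'I_(n i).+1} -> nat) (q_inj : injective q)
    (q_prime : forall x, prime (q x)) (a : tindex d n) i (l : 'I_(n i).+1) :
  logn (q (existT _ i l)) (\prod_i \prod_(j < d i) q (existT _ i (a i j)))%N
    = #|[pred j | a i j == l]|.
Proof.
have logn_prod (J : finType) (f : J -> nat) p : (forall j, 0 < f j)%N ->
    logn p (\prod_j f j)%N = (\sum_j logn p (f j))%N.
  move=> f_gt0; have [] // : (0 < \prod_j f j)%N /\
      logn p (\prod_j f j)%N = (\sum_j logn p (f j))%N.
  elim/big_ind2: _ => [|x x' y y' [? <-] [? <-]|j _]; rewrite ?logn1 //.
  by rewrite muln_gt0 lognM //; split=> //; apply/andP.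
rewrite logn_prod => [|i']; last first.
  by rewrite prodn_gt0 // => j; apply: prime_gt0.
rewrite (bigD1 i) //= logn_prod => [|j]; last exact: prime_gt0.
rewrite [X in (_ + X)%N]big1 ?addn0 => [|i' i'i]; last first.
  rewrite logn_prod => [|j]; last exact: prime_gt0.
  rewrite big1 // => j _; rewrite logn_prime // (inj_eq q_inj).
  by case: eqP => // /(congr1 tag) /= ii'; rewrite ii' eqxx in i'i.
rewrite -sum1_card [RHS]big_mkcond; apply: eq_bigr => j _.
by rewrite logn_prime // (inj_eq q_inj) eq_Tagged eq_sym inE; case: (_ == _).
Qed.

Lemma prime_product_tindex_perm (k : nat) (d n : 'I_k -> nat)
    (q : {i : 'I_k & 'I_(n i).+1} -> nat) (q_inj : injective q)
    (q_prime : forall x, prime (q x)) (a b : tindex d n) :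
  (\prod_i \prod_(j < d i) q (existT _ i (a i j)))%N
    = (\prod_i \prod_(j < d i) q (existT _ i (b i j)))%N ->
  exists s : forall i : 'I_k, {perm 'I_(d i)}, a = tindex_perm s b.
Proof.
move=> eq_ab; apply: eq_occurrences_tindex_perm => i l.
by rewrite -!(logn_prime_product q_inj q_prime) eq_ab.
Qed.

(** Casting the prime products into [C] loses nothing, as [C] has
    characteristic 0. *)
Lemma exists_separating_power_tensor (C : numClosedFieldType) (k : nat)
    (d n : 'I_k -> nat) :
  exists v : forall i : 'I_k, 'rV[C]_(n i).+1,
    forall a b : tindex d n, power_tensor d v a = power_tensor d v b ->
      exists s : forall i : 'I_k, {perm 'I_(d i)}, a = tindex_perm s b.
Proof.
have [q [q_inj q_prime]] := exists_distinct_primes {i : 'I_k & 'I_(n i).+1}.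
exists (fun i => \row_l (q (existT _ i l))%:R) => a b.
have vE c : power_tensor d (fun i => \row_l (q (existT _ i l))%:R) c
    = (\prod_i \prod_(j < d i) q (existT _ i (c i j)))%N%:R :> C.
  rewrite ffunE natr_prod; apply: eq_bigr => i _; rewrite natr_prod.
  by apply: eq_bigr => j _; rewrite mxE.
rewrite !vE => /eqP; rewrite eqr_nat => /eqP.
exact: prime_product_tindex_perm.
Qed.

(** Writing [T = p(u)] with [u] separating, the factors of [T] are the linear
    factors of [p] evaluated at [u]. *)
Lemma hadamard_prod_rank2 (C : numClosedFieldType) (k : nat)
    (d n : 'I_k -> nat) (i0 : 'I_k) (T : tensor C d n) :
  (0 < d i0)%N -> partially_symmetric T ->
  exists (m : nat) (A : 'I_m -> tensor C d n),
    [/\ (0 < m)%N,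
        forall l, partially_symmetric (A l) /\ has_ps_decomposition (A l) 2
      & T = hadamard_prod A].
Proof.
move=> d_gt0 Tsym.
have [v v_sep] := exists_separating_power_tensor C d n.
have [|p pE] := @interpolation_fiber C _ (power_tensor d v) T.
  by move=> a b /v_sep[s ->]; apply: Tsym.
have [z pz] := closed_field_poly_normal p.
(* The leading coefficient of [p] is taken as the factor [0 u + lead_coef p],
   so the list of factors is nonempty even when [p] is constant. *)
pose e : seq (C * C) := (0, lead_coef p) :: [seq (1, - x) | x <- z].
pose A (l : 'I_(size e)) : tensor C d n :=
  [ffun a => (e`_l).1 * power_tensor d v a + (e`_l).2].
exists (size e), A; split=> // [l|].
  split; last exact: has_ps_decomposition_affine_power_tensor d_gt0.
  by move=> s a; rewrite [LHS]ffunE [RHS]ffunE partially_symmetric_power_tensor.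
apply/ffunP => a; rewrite ffunE -pE pz hornerZ horner_prod.
transitivity (\prod_(c <- e) (c.1 * power_tensor d v a + c.2)).
  rewrite big_cons mul0r add0r big_map; congr (_ * _).
  by apply: eq_bigr => x _; rewrite hornerXsubC mul1r.
by rewrite (big_nth 0) big_mkord; apply: eq_bigr => l _; rewrite [RHS]ffunE.
Qed.

End HadamardFactorization.

Theorem corollary3p9 (R : realType) (r : nat) (hr : (2 <= r)%N)
    (k : nat) (hk : (1 <= k)%N) (d n : 'I_k -> nat)
    (hd : forall i : 'I_k, (1 <= d i)%N) (hn : forall i : 'I_k, (1 <= n i)%N)
    (T : tensor (complex R) d n) (hT : partially_symmetric T) :
  exists (m : nat) (A : 'I_m -> tensor (complex R) d n),
    (1 <= m)%N /\
    (forall l : 'I_m, partially_symmetric (A l) /\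
       exists s : nat, is_ps_rank (A l) s /\ (s <= r)%N) /\
    T = hadamard_prod A.
Proof.
have [m [A [m_gt0 A2 TA]]] :=
  @hadamard_prod_rank2 (complex R) k d n (Ordinal hk) T (hd _) hT.
exists m, A; split=> //; split=> // l.
have [Asym /exists_ps_rank_le[s [As s2]]] := A2 l.
by split=> //; exists s; split=> //; apply: leq_trans s2 hr.
Qed.
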